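(* Let $0<r<R$ and let $p(x)=\sum_{n=2}^\infty \frac{a_n}{x^n}$ be a real analytic function, the series being absolutely convergent for $|x|>r$, such that $p(x)\ge 0$ for all real $x$ with $|x|\ge R$. Let $\lambda$ be the positive measure $\lambda(dx)=p(x)\mathbf{1}_{\{|x|\ge R\}}(x)\,dx$ on $(-\infty,-R]\cup[R,\infty)$. Then the Fourier transform $\mathcal{F}_\lambda(z)$, considered for $z>0$ only, is the restriction to $(0,\infty)$ of an entire function $\widetilde{\mathcal{F}}_\lambda$. Therefore there are complex numbers $c_n$ ($n\ge0$) such that the Taylor series $$\widetilde{\mathcal{F}}_\lambda(z)=\sum_{n=0}^\infty\frac{c_n}{n!}(iz)^n$$ is convergent for all $z\in\mathbb{C}$.
   Context: For a finite positive measure $\lambda$ on $\mathbb{R}$, the Fourier transform is $\mathcal{F}_\lambda(z)=\int_{\mathbb{R}}e^{ixz}\lambda(dx)$ for $z\in\mathbb{R}$. *)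

(* Defs.v *)
From mathcomp Require Export all_boot all_order all_algebra.
From mathcomp Require Export complex.
From mathcomp Require Export all_classical all_reals all_analysis.

Set Implicit Arguments.
Unset Strict Implicit.
Unset Printing Implicit Defensive.

Import Order.TTheory GRing.Theory Num.Theory numFieldNormedType.Exports.

Local Open Scope classical_set_scope.
Local Open Scope ring_scope.
Local Open Scope complex_scope.

(* The integral of a complex-valued function, taken componentwise. *)
Definition Cintegral (d : measure_display) (T : measurableType d)
    (R : realType) (mu : {measure set T -> \bar R}) (D : set T)
    (f : T -> R[i]) : R[i] :=
  (\int[mu]_(x in D) complex.Re (f x)) +i* (\int[mu]_(x in D) complex.Im (f x)).

(* e^{it} for real t. *)
Definition expi (R : realType) (t : R) : R[i] := cos t +i* sin t.

(* Meaningful for finite lam: the integrand is then bounded and integrable. *)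
Definition fourier (R : realType)
    (lam : {measure set (measurableTypeR R) -> \bar R}) (z : R) : R[i] :=
  Cintegral lam setT (fun x => expi (x * z)).

(* lam(dx) = f(x) dx *)
Definition has_density (R : realType)
    (lam : {measure set (measurableTypeR R) -> \bar R}) (f : R -> R) : Prop :=
  forall A : set (measurableTypeR R), measurable A ->
    lam A = (\int[@lebesgue_measure R]_(x in A) (f x)%:E)%E.

(* The regular module R[i]^o carries the normed-module structure over R[i],
   so the derivative below is the complex one. *)
Definition entire (R : realType) (F : R[i]^o -> R[i]^o) : Prop :=
  forall z : R[i]^o, derivable F z 1.

(* Main.v *)
From HB Require Import structures.
Require Import Defs.
From mathcomp Require Import measurable_realfun ring.
Set Implicit Arguments.
Unset Strict Implicit.
Unset Printing Implicit Defensive.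
Import Order.TTheory GRing.Theory Num.Theory numFieldNormedType.Exports.
Local Open Scope classical_set_scope.
Local Open Scope ring_scope.

(** By parity, the real and imaginary parts of the Fourier transform are sums
    over [k >= 2] of [2 a_k] times the integral over [[rho, +oo[] of
    [trig (x z) / x ^ k], where [trig] is [cos] for even [k] and [sin] for odd
    [k]. Integrate the Taylor series of [trig t / t ^ k] termwise: since the
    parity of [trig] excludes the exponent [-1], no logarithm appears and the
    primitive is [osc t = Q t / t ^ (k - 1)] with [Q] entire. It has a limit
    [kappa] at infinity, so by scaling the integral is
    [kappa * z ^ (k - 1) - rho ^ (1 - k) * Q (rho * z)] for [z > 0], an entire
    function of [z]. This is where [z > 0] matters: for negative [z] the
    limit at [-oo] would replace [kappa]. The tail estimate
    [|osc t - kappa| <= t ^ (1 - k)] at [t = rho * z], combined with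
    [sum |a_k| rho ^ (-k) < oo], makes the double series in [k] and in the
    powers of [z] absolutely convergent for every [z]. *)

(** * Power series with coefficients bounded by [1 / n!] *)

Section fact_bounded_series.
Variable R : realType.
Implicit Types (f : nat -> R) (x : R).

Definition fact_bounded f := forall n, `|f n| <= n`!%:R^-1.

(** The factor [n.+1] produced by differentiation turns [1 / n.+1!] into [1 / n!]. *)
Lemma fact_bounded_diffs f : fact_bounded f -> fact_bounded (pseries_diffs f).
Proof.
move=> fb n; rewrite /pseries_diffs normrM normr_nat.
rewrite (le_trans (ler_wpM2l _ (fb n.+1)))//.
by rewrite factS natrM invfM mulrA divff ?mul1r.
Qed.

Lemma fact_bounded_norm_cvg f x : fact_bounded f ->
  cvgn [normed pseries f x].
Proof.
move=> fb; apply: series_le_cvg (is_cvg_series_exp_coeff `|x|).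
- by move=> n; rewrite normr_ge0.
- by move=> n; rewrite divr_ge0.
- by move=> n /=; rewrite normrM normrX mulrC ler_wpM2l// exprn_ge0.
Qed.

Lemma fact_bounded_cvg f x : fact_bounded f -> cvgn (pseries f x).
Proof. by move=> fb; apply: normed_cvg; exact: fact_bounded_norm_cvg. Qed.

Lemma fact_bounded_le f x : fact_bounded f ->
  `|limn (pseries f x)| <= expR `|x|.
Proof.
move=> fb; rewrite /pseries.
have := @lim_series_norm R R _ (@fact_bounded_norm_cvg f x fb).
move/le_trans; apply.
apply: ler_lim; [exact: fact_bounded_norm_cvg|exact: is_cvg_series_exp_coeff|].
apply: nearW => n; apply: ler_sum => i _.
by rewrite /= normrM normrX mulrC ler_wpM2l// exprn_ge0.
Qed.

Lemma fact_bounded_derive f x : fact_bounded f ->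
  is_derive x (1 : R) (fun x => limn (pseries f x))
    (limn (pseries (pseries_diffs f) x)).
Proof.
move=> fb; have fb1 := fact_bounded_diffs fb.
apply: (@pseries_snd_diffs _ _ (`|x| + 1)); try exact: fact_bounded_cvg.
  exact/fact_bounded_cvg/fact_bounded_diffs.
by rewrite [ltRHS]ger0_norm ?ltrDl// addr_ge0.
Qed.

End fact_bounded_series.

(** * Taylor series of cosine and sine, and the numerator [prim] of the primitive *)

Section cosine_and_sine.
Variable R : realType.
Implicit Types (d : bool) (n m : nat) (x : R).

(* [d = false] is cosine and [d = true] is sine, so that [d] is the parity of
   the exponents in the Taylor series. *)
Definition trig d : R -> R := if d then @sin R else @cos R.

Definition trig_coef d n : R :=
  if d then (odd n)%:R * (-1) ^+ n.-1./2 * n`!%:R^-1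
  else (~~ odd n)%:R * (-1) ^+ n./2 * n`!%:R^-1.

Lemma trigE d x : trig d x = limn (pseries (trig_coef d) x).
Proof. by case: d; rewrite /trig /trig_coef ?sinE ?cosE. Qed.

Lemma trig_le1 d x : `|trig d x| <= 1.
Proof.
by case: d => /=; rewrite ler_norml ?sin_geN1 ?cos_geN1 ?sin_le1 ?cos_le1.
Qed.

Lemma trigN d x : trig d (- x) = (-1) ^+ d * trig d x.
Proof. by case: d; rewrite /= ?sinN ?cosN ?mulN1r ?mul1r. Qed.

Lemma continuous_trig d : continuous (trig d).
Proof. by case: d => /=; [exact: continuous_sin|exact: continuous_cos]. Qed.

Lemma trig_coef_fact d : fact_bounded (trig_coef d).
Proof.
move=> n; rewrite /trig_coef; case: d; rewrite !normrM normrX normrN1 expr1n mulr1;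
by rewrite normr_nat [X in _ * X]ger0_norm ?invr_ge0//; case: odd;
  rewrite ?mul0r ?mul1r ?invr_ge0.
Qed.

Lemma trig_coef0 d n : odd n = ~~ d -> trig_coef d n = 0.
Proof. by case: d => /= odd_n; rewrite /trig_coef odd_n !mul0r. Qed.

(* Only used for [odd n = ~~ d]: then the term [m = n], where the division by
   zero gives [0], is absent from the Taylor series of [trig d] anyway. *)
Definition prim_coef d n m : R := trig_coef d m / (m%:R - n%:R).

(** A nonzero integer [m - n] has absolute value at least [1], and at [m = n] the quotient is
    [0]. *)
Lemma prim_coef_fact d n : fact_bounded (prim_coef d n).
Proof.
move=> m; apply: le_trans (trig_coef_fact d m).
rewrite /prim_coef normrM normfV ler_piMr//.
have [->|mn] := eqVneq m n; first by rewrite subrr normr0 invr0.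
rewrite invf_le1 ?normr_gt0 ?subr_eq0 ?eqr_nat//.
by case: (ltngtP m n) mn => // lmn _; [rewrite distrC|];
  rewrite -natrB 1?ltnW// normr_nat ler1n subn_gt0.
Qed.

Definition prim d n x : R := limn (pseries (prim_coef d n) x).

Lemma prim_le d n x : `|prim d n x| <= expR `|x|.
Proof. exact/fact_bounded_le/prim_coef_fact. Qed.

(** On the coefficient of [x ^ m], the operator [x Q' - n Q] acts as multiplication by [m - n],
    which cancels the division in [prim_coef]. The parity hypothesis makes the term [m = n] of the
    Taylor series vanish. *)
Lemma prim_ode d n x : odd n = ~~ d ->
  x * limn (pseries (pseries_diffs (prim_coef d n)) x) - n%:R * prim d n x
  = trig d x.
Proof.
move=> odd_n; have fb := @prim_coef_fact d n.
have c0 := @fact_bounded_cvg _ _ x fb.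
have c1 := @fact_bounded_cvg _ _ x (fact_bounded_diffs fb).
rewrite trigE /prim; apply/esym/cvg_lim => //.
(* Multiplication by [x] raises degrees by one, so [N] terms of [x Q'] face [N.+1] terms of [Q]. *)
have c2 : (fun N => x * pseries (pseries_diffs (prim_coef d n)) x N
                    - n%:R * pseries (prim_coef d n) x N.+1) @ \oo -->
  x * limn (pseries (pseries_diffs (prim_coef d n)) x) - n%:R * prim d n x.
  by apply: cvgB; apply: cvgMl_tmp => //; rewrite (cvg_shiftS (pseries _ _)).
rewrite -cvg_shiftS; apply: cvg_trans c2.
apply: near_eq_cvg; apply: nearW => N; rewrite /pseries /series /=.
have coefM m : prim_coef d n m * (m%:R - n%:R) = trig_coef d m.
  have [->|mn] := eqVneq m n; first by rewrite subrr mulr0 trig_coef0.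
  by rewrite /prim_coef divfK// subr_eq0 eqr_nat.
rewrite !mulr_sumr [in LHS]big_nat_recl// [RHS]big_nat_recl// -coefM.
under [in RHS]eq_bigr do rewrite -coefM.
rewrite opprD addrCA -sumrB sub0r mulrN mulNr; congr (_ + _); first by ring.
by apply: eq_bigr => i _; rewrite /pseries_diffs exprS; ring.
Qed.

End cosine_and_sine.

(** * Fundamental theorem of calculus on half-lines *)

Section improper_FTC.
Variable R : realType.
Local Notation mu := (@lebesgue_measure R).

Lemma continuous_within_itvcy (f : R -> R) a :
  (forall x, a <= x -> {for x, continuous f}) ->
  {within `[a, +oo[, continuous f}.
Proof.
move=> cf; apply: continuous_in_subspaceT => x.
by rewrite inE/= in_itv/= andbT => /cf.
Qed.

Lemma ge0_improper_FTC (g G : R -> R) (a l : R) :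
  (forall x, a <= x -> 0 <= g x) ->
  (forall x, a <= x -> {for x, continuous g}) ->
  (forall x, a <= x -> is_derive x 1 G (g x)) ->
  G x @[x --> +oo] --> l ->
  mu.-integrable `[a, +oo[ (EFin \o g) /\
  \int[mu]_(x in `[a, +oo[) g x = l - G a.
Proof.
move=> g0 cg dG Gl.
have E : (\int[mu]_(x in `[a, +oo[) (g x)%:E = l%:E - (G a)%:E)%E.
  apply: ge0_continuous_FTC2y => //.
  - exact: continuous_within_itvcy.
  - by move=> x /ltW /dG [].
  - apply: cvg_at_right_filter; apply: differentiable_continuous.
    by apply/derivable1_diffP; have [] := dG a (lexx a).
  - move=> x; rewrite in_itv/= andbT => /ltW /dG ?; rewrite derive1E.
    exact: derive_val.
split; last by rewrite /Rintegral E -EFinB.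
apply/integrableP; split.
  apply/measurable_EFinP; apply: subspace_continuous_measurable_fun => //.
  exact: continuous_within_itvcy.
under eq_integral => x.
  rewrite inE/= in_itv/= andbT => ax; rewrite ger0_norm ?g0//.
  over.
by rewrite E -EFinB ltry.
Qed.

(** Since [|f| <= g], both [f + g] and [g] are nonnegative and fall under [ge0_improper_FTC]; [f] is
    their difference. *)
Lemma dominated_improper_FTC (f F g G : R -> R) (a l m : R) :
  (forall x, a <= x -> `|f x| <= g x) ->
  (forall x, a <= x -> {for x, continuous f}) ->
  (forall x, a <= x -> {for x, continuous g}) ->
  (forall x, a <= x -> is_derive x 1 F (f x)) ->
  (forall x, a <= x -> is_derive x 1 G (g x)) ->
  F x @[x --> +oo] --> l ->
  G x @[x --> +oo] --> m ->
  mu.-integrable `[a, +oo[ (EFin \o f) /\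
  \int[mu]_(x in `[a, +oo[) f x = l - F a.
Proof.
move=> fg cf cg dF dG Fl Gm.
have [ig Eg] : mu.-integrable `[a, +oo[ (EFin \o g) /\
    \int[mu]_(x in `[a, +oo[) g x = m - G a.
  by apply: ge0_improper_FTC => // x ax; exact: le_trans (fg _ ax).
have [ifg Efg] : mu.-integrable `[a, +oo[ (EFin \o (f + g)) /\
    \int[mu]_(x in `[a, +oo[) (f + g) x = (l + m) - (F + G) a.
  apply: ge0_improper_FTC.
  - move=> x ax /=; have := fg _ ax.
    by rewrite ler_norml => /andP[+ _]; rewrite -subr_ge0 opprK.
  - by move=> x ax; apply: cvgD; [exact: cf|exact: cg].
  - by move=> x ax; have := dF _ ax; have := dG _ ax => ? ?; exact: is_deriveD.
  - exact: cvgD.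
have fE : f = (f + g) - g by apply/funext => x; rewrite !fctE addrK.
split.
  rewrite (_ : EFin \o f = ((EFin \o (f + g)%R) \- (EFin \o g))%E).
    exact: integrableB.
  by apply/funext => x /=; rewrite -EFinB !fctE addrK.
by rewrite fE RintegralB// Efg Eg !fctE; ring.
Qed.

End improper_FTC.

(** * The primitive [osc], its limit at infinity, and the half-line integrals *)

Section oscillating_primitive.
Variable R : realType.
Local Notation mu := (@lebesgue_measure R).
Implicit Types (d : bool) (n : nat) (x z : R).

(* The primitive of [trig d x / x ^+ n.+1] on [x > 0] when [odd n = ~~ d]. *)
Definition osc d n x : R := prim d n x / x ^+ n.

Lemma is_derive_expV n x : x != 0 ->
  is_derive x 1 (fun t : R => t ^- n) (- n%:R * x ^- n.+1).
Proof.
move=> x0.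
have dX : is_derive x 1 (fun t : R => t ^+ n) (n%:R * x ^+ n.-1).
  apply: DeriveDef; first exact: exprn_derivable.
  by rewrite exp_derive /GRing.scale/= mulr1.
apply: is_derive_eq; first by apply: is_deriveV; rewrite expf_neq0.
case: n dX => [|n] _; first by rewrite !mul0r oppr0 mul0r scaler0.
by rewrite /GRing.scale/= !exprS; field; rewrite x0 expf_neq0.
Qed.

(** The quotient rule gives [(x Q' - n Q) / x ^ n.+1] with [Q = prim d n], and [prim_ode] identifies
    the numerator. *)
Lemma is_derive_osc d n x : odd n = ~~ d -> 0 < x ->
  is_derive x 1 (osc d n) (trig d x / x ^+ n.+1).
Proof.
move=> odd_n x0; have xn0 : x != 0 by rewrite gt_eqF.
have dV := is_derive_expV n xn0.
have dP := fact_bounded_derive x (@prim_coef_fact R d n).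
have dO : is_derive x 1 (osc d n) _ := is_deriveM dP dV.
apply: is_derive_eq dO _.
rewrite -(prim_ode x odd_n) /GRing.scale/= -/(prim d n x) exprS; field.
by rewrite xn0 expf_neq0.
Qed.

(** The derivative of [osc] is at most [x ^- n.+1 <= n * x ^- n.+1] in absolute value, and the
    latter is minus the derivative of [x ^- n]. Hence [osc - x ^- n] is nondecreasing and
    [osc + x ^- n] is nonincreasing. *)
Lemma osc_tail_bounds d n s t : odd n = ~~ d -> (0 < n)%N -> 0 < s -> s <= t ->
  osc d n s - s ^- n <= osc d n t - t ^- n /\
  osc d n t + t ^- n <= osc d n s + s ^- n.
Proof.
move=> odd_n n0 s0 st.
have dO x : s <= x -> is_derive x 1 (osc d n) (trig d x / x ^+ n.+1).
  by move=> sx; apply: is_derive_osc => //; exact: lt_le_trans sx.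
have dV x : s <= x -> is_derive x 1 (fun t => t ^- n) (- n%:R * x ^- n.+1).
  by move=> sx; apply: is_derive_expV; rewrite gt_eqF// (lt_le_trans s0).
have bnd x : s <= x -> `|trig d x / x ^+ n.+1| <= n%:R * x ^- n.+1.
  move=> sx; have x0 := lt_le_trans s0 sx.
  rewrite normrM normfV (gtr0_norm (exprn_gt0 _ x0))//.
  rewrite ler_wpM2r// ?invr_ge0 ?exprn_ge0 ?(ltW x0)//.
  by apply: le_trans (trig_le1 _ _) _; rewrite ler1n.
split.
- apply: (@ger0_derive1_ndecry R (osc d n - (fun t => t ^- n)) s) => //.
  + move=> x; rewrite in_itv/= andbT => /ltW sx.
    by have := dO _ sx; have := dV _ sx => ? ?; apply: derivableB.
  + move=> x; rewrite in_itv/= andbT => /ltW sx.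
    have := dO _ sx; have := dV _ sx => ? ?.
    rewrite derive1E derive_val mulNr opprK.
    by have := bnd _ sx; rewrite ler_norml -subr_ge0 opprK => /andP[].
  + apply: continuous_within_itvcy => x sx.
    apply: differentiable_continuous; apply/derivable1_diffP.
    by have := dO _ sx; have := dV _ sx => ? ?; apply: derivableB.
- apply: (@ler0_derive1_nincry R (osc d n + (fun t => t ^- n)) s) => //.
  + move=> x; rewrite in_itv/= andbT => /ltW sx.
    by have := dO _ sx; have := dV _ sx => ? ?; apply: derivableD.
  + move=> x; rewrite in_itv/= andbT => /ltW sx.
    have := dO _ sx; have := dV _ sx => ? ?.
    rewrite derive1E derive_val mulNr subr_le0.
    by have := bnd _ sx; rewrite ler_norml => /andP[].
  + apply: continuous_within_itvcy => x sx.
    apply: differentiable_continuous; apply/derivable1_diffP.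
    by have := dO _ sx; have := dV _ sx => ? ?; apply: derivableD.
Qed.

(** The limit of [osc] at infinity, for [0 < n] and [odd n = ~~ d]: the supremum of a nondecreasing
    function that differs from [osc] by the vanishing term [t ^- n]. *)
Definition osc_lim d n : R :=
  sup [set osc d n t - t ^- n | t in [set t : R | 0 < t]].

(** Comparison at the larger of two points shows that every value of [osc - t ^- n] lies below every
    value of [osc + t ^- n]; the supremum of the former therefore lies between the two at each
    [t]. *)
Lemma osc_limP d n t : odd n = ~~ d -> (0 < n)%N -> 0 < t ->
  `|osc d n t - osc_lim d n| <= t ^- n.
Proof.
move=> odd_n n0 t0.
have ub : ubound [set osc d n t - t ^- n | t in [set t : R | 0 < t]]
    (osc d n t + t ^- n).
  move=> _ [s /= s0 <-].
  have m0 : 0 < Num.max s t by rewrite lt_max s0.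
  have [|h1 _] := @osc_tail_bounds d n s (Num.max s t) odd_n n0 s0.
    by rewrite le_max lexx.
  have [|_ h2] := @osc_tail_bounds d n t (Num.max s t) odd_n n0 t0.
    by rewrite le_max lexx orbT.
  apply: le_trans h1 (le_trans _ h2).
  by rewrite lerD2l ge0_cp// invr_ge0 exprn_ge0// ltW.
rewrite ler_distlC; apply/andP; split.
  by apply: ub_le_sup; [eexists; exact: ub|exists t].
by apply: ge_sup => //; exists (osc d n t - t ^- n), t.
Qed.

Lemma cvg_expV n : (0 < n)%N -> x ^- n @[x --> +oo] --> (0 : R).
Proof.
move=> n0; apply/cvgrPdist_le => e e0; near=> x.
have x1 : 1 <= x by near: x; apply: nbhs_pinfty_ge; rewrite num_real.
have xe : e^-1 <= x by near: x; apply: nbhs_pinfty_ge; rewrite num_real.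
have x0 : 0 < x by apply: lt_le_trans x1.
rewrite sub0r normrN gtr0_norm ?invr_gt0 ?exprn_gt0//.
rewrite -[leRHS]invrK lef_pV2 ?posrE ?exprn_gt0 ?invr_gt0//.
by rewrite (le_trans xe)// ler_eXnr.
Unshelve. all: by end_near. Qed.

Lemma cvg_osc d n : odd n = ~~ d -> (0 < n)%N ->
  osc d n x @[x --> +oo] --> osc_lim d n.
Proof.
move=> odd_n n0; apply/cvgrPdist_le => e e0.
have /cvgrPdist_le /(_ e e0) := cvg_expV n0.
apply: filter_app; near=> x.
have x0 : 0 < x by near: x; apply: nbhs_pinfty_gt; rewrite num_real.
rewrite sub0r normrN gtr0_norm ?invr_gt0 ?exprn_gt0// => /(le_trans _); apply.
by rewrite distrC osc_limP.
Unshelve. all: by end_near. Qed.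

Lemma continuous_expV n (x : R) : x != 0 ->
  {for x, continuous (fun x : R => x ^- n)}.
Proof.
by move=> x0; apply: cvgV; rewrite ?expf_neq0//; exact: exprn_continuous.
Qed.

Lemma continuous_trig_expV d n z x : 0 < x ->
  {for x, continuous (fun x => trig d (x * z) / x ^+ n)}.
Proof.
move=> x0; apply: cvgM; last by apply: continuous_expV; rewrite gt_eqF.
apply: (@continuous_comp _ _ _ (fun x => x * z) (trig d)).
  exact: mulrr_continuous.
exact: continuous_trig.
Qed.

Lemma is_derive_scale_expV n x : (0 < n)%N -> x != 0 ->
  is_derive x 1 (fun x : R => - n%:R^-1 * x ^- n) (x ^- n.+1).
Proof.
move=> n0 x0.
have dM : is_derive x 1 (fun x : R => - n%:R^-1 * x ^- n) _ :=
  is_deriveM (is_derive_cst (- n%:R^-1 : R) x (1 : R)) (is_derive_expV n x0).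
apply: is_derive_eq dM _.
rewrite /GRing.scale/= mulr0 addr0 mulrA mulrNN mulVf ?mul1r//.
by rewrite pnatr_eq0 -lt0n.
Qed.

Lemma integrable_expV n rho : (0 < n)%N -> 0 < rho ->
  mu.-integrable `[rho, +oo[ (EFin \o (fun x : R => x ^- n.+1)).
Proof.
move=> n0 rho0; have pos x : rho <= x -> 0 < x by exact: lt_le_trans.
apply: (@ge0_improper_FTC R _ (fun x => - n%:R^-1 * x ^- n) _
  (- n%:R^-1 * 0) _ _ _ _).1.
- by move=> x /pos x0; rewrite invr_ge0 exprn_ge0// ltW.
- by move=> x /pos x0; apply: continuous_expV; rewrite gt_eqF.
- by move=> x /pos x0; apply: is_derive_scale_expV => //; rewrite gt_eqF.
- by apply: cvgMl_tmp; exact: cvg_expV.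
Qed.

(** By scaling, [osc d n (x * z) * z ^+ n] is a primitive of the integrand; its limit involves
    [osc_lim] because [x * z] tends to [+oo] when [z > 0]. The dominating function is
    [x ^- n.+1]. *)
Lemma integral_osc d n rho z : odd n = ~~ d -> (0 < n)%N -> 0 < rho -> 0 < z ->
  mu.-integrable `[rho, +oo[ (EFin \o (fun x => trig d (x * z) / x ^+ n.+1)) /\
  \int[mu]_(x in `[rho, +oo[) (trig d (x * z) / x ^+ n.+1) =
    osc_lim d n * z ^+ n - prim d n (rho * z) / rho ^+ n.
Proof.
move=> odd_n n0 rho0 z0.
have pos x : rho <= x -> 0 < x by exact: lt_le_trans.
have dmul x : is_derive x 1 (fun x : R => x * z) z.
  have dz : is_derive x 1 ( *%R^~ z) _ :=
    is_deriveM (is_derive_id x (1 : R)) (is_derive_cst z x (1 : R)).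
  by apply: is_derive_eq dz _; rewrite /GRing.scale/= mulr0 add0r mulr1.
have [||||||| intf ->] := @dominated_improper_FTC R
  (fun x => trig d (x * z) / x ^+ n.+1) (fun x => osc d n (x * z) * z ^+ n)
  (fun x => x ^- n.+1) (fun x => - n%:R^-1 * x ^- n) rho
  (osc_lim d n * z ^+ n) (- n%:R^-1 * 0).
- move=> x /pos x0; rewrite normrM normfV (gtr0_norm (exprn_gt0 _ x0)).
  by rewrite ler_piMl ?trig_le1// invr_ge0 exprn_ge0// ltW.
- by move=> x /pos; exact: continuous_trig_expV.
- by move=> x /pos x0; apply: continuous_expV; rewrite gt_eqF.
- move=> x /pos x0.
  have dO := is_derive_osc odd_n (mulr_gt0 x0 z0).
  have dc : is_derive x 1 (osc d n \o (fun x => x * z)) _ :=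
    @is_derive1_comp R (osc d n) (fun x => x * z) x _ _ dO (dmul x).
  have dM : is_derive x 1 (fun x => osc d n (x * z) * z ^+ n) _ :=
    is_deriveM dc (is_derive_cst (z ^+ n) x (1 : R)).
  apply: is_derive_eq dM _; rewrite /GRing.scale/= exprMn !exprS; field.
  by rewrite !expf_neq0 ?gt_eqF.
- by move=> x /pos x0; apply: is_derive_scale_expV => //; rewrite gt_eqF.
- apply: cvgMr_tmp.
  apply: (@cvg_comp _ _ _ (fun x => x * z) (osc d n) _ +oo); last exact: cvg_osc.
  exact: gt0_cvgMly.
- by apply: cvgMl_tmp; exact: cvg_expV.
- split=> //; rewrite /osc exprMn; congr (_ - _); field.
  by rewrite !expf_neq0 ?gt_eqF.
Qed.

End oscillating_primitive.

(** * Integrals over [rho <= |x|], reduced to a half-line by parity *)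

Section outer_integral.
Variable R : realType.
Local Notation mu := (@lebesgue_measure R).
Implicit Types (f h : R -> R) (rho : R).

(** Lebesgue measure is its own pushforward under [-%R]. *)
Lemma integral_opp h : mu.-integrable setT (EFin \o h) ->
  mu.-integrable setT (EFin \o (h \o -%R)) /\
  \int[mu]_x h (- x) = \int[mu]_x h x.
Proof.
move=> ih; pose T := measurableTypeR R.
have mN : measurable_fun [set: T] (-%R : T -> T) by [].
have mh : measurable_fun [set: T] (h : T -> R).
  by apply/measurable_EFinP; exact: measurable_int ih.
have mf : measurable_fun [set: T] (EFin \o (h \o -%R) : T -> \bar R).
  by apply/measurable_EFinP; exact: measurableT_comp mh mN.
have intf : mu.-integrable ((-%R : T -> T) @^-1` setT)
    ((EFin \o (h \o -%R) : T -> \bar R) \o -%R).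
  rewrite preimage_setT; apply: eq_integrable ih => //.
  by move=> x _ /=; rewrite opprK.
split.
  apply/integrableP; split; first exact: mf.
  have /integrableP[_] := integrable_pushforward mN mf intf measurableT.
  apply: le_lt_trans; rewrite le_eqVlt; apply/orP; left; apply/eqP.
  by apply: eq_measure_integral => A mA _; exact/esym/lebesgue_measureN.
rewrite /Rintegral; congr fine.
transitivity (\int[pushforward mu (-%R : T -> T)]_x
    (EFin \o (h \o -%R) : T -> \bar R) x)%E.
  by apply: eq_measure_integral => A mA _; exact/esym/lebesgue_measureN.
rewrite (@integral_pushforward _ _ _ _ _ _ mN mu setT _ mf intf)// preimage_setT.
by apply: eq_integral => x _ /=; rewrite opprK.
Qed.

Definition outer rho : set R := [set x | rho <= `|x|].

Lemma mem_outer rho x : (x \in outer rho) = (rho <= `|x|).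
Proof. by apply/idP/idP; rewrite inE. Qed.

Lemma measurable_outer rho : measurable (outer rho : set (measurableTypeR R)).
Proof.
rewrite (_ : outer rho = (@Num.norm R R) @^-1` `[rho, +oo[).
  by rewrite -[X in measurable X]setTI; exact: normr_measurable.
by apply/seteqP; split => x /=; rewrite in_itv/= andbT.
Qed.

(** With [h] the restriction of [f] to the positive half-line, the restriction of [f] to [outer rho]
    is [h] plus [s] times the reflection of [h]; the two supports are disjoint as [rho > 0]. *)
Lemma outer_integral f rho (s : R) : 0 < rho ->
  (forall x, rho <= x -> f (- x) = s * f x) ->
  mu.-integrable `[rho, +oo[ (EFin \o f) ->
  mu.-integrable (outer rho) (EFin \o f) /\
  \int[mu]_(x in outer rho) f x = (1 + s) * \int[mu]_(x in `[rho, +oo[) f x.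
Proof.
move=> rho0 fs intf.
pose h := f \_ `[rho, +oo[.
have ih : mu.-integrable setT (EFin \o h).
  rewrite /h -restrict_EFin; exact/(integrable_mkcond _ _).1.
have [ihN ehN] := integral_opp ih.
have fD : f \_ (outer rho) = h + s *: (h \o -%R).
  apply/funext => x; rewrite /h !fctE !patchE /= /GRing.scale/=.
  rewrite mem_outer !mem_setE !in_itv/= !andbT.
  have [x0|x0] := leP 0 x.
    rewrite [(rho <= - x)]lt_geF ?mulr0 ?addr0 ?ger0_norm//.
    by rewrite (le_lt_trans _ rho0)// oppr_le0.
  rewrite [(rho <= x)]lt_geF ?add0r; last exact: lt_trans rho0.
  rewrite ltr0_norm//; case: ifPn => rx.
    by rewrite -fs// opprK.
  by rewrite mulr0.
have ishN : mu.-integrable setT (EFin \o (s *: (h \o -%R))).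
  rewrite (_ : _ \o _ = (fun x => s%:E * (EFin \o (h \o -%R)) x)%E).
    exact: integrableZl.
  by apply/funext => x /=; rewrite -EFinM.
split.
  apply/(integrable_mkcond _ (measurable_outer rho)).2.
  rewrite restrict_EFin fD.
  rewrite (_ : _ \o _ = ((EFin \o h) \+ (EFin \o (s *: (h \o -%R))%R))%E).
    exact: integrableD.
  by apply/funext => x /=; rewrite -EFinD.
rewrite Rintegral_mkcond fD [X in _ = _ * X]Rintegral_mkcond -/h RintegralD//.
by rewrite mulrDl mul1r RintegralZl// ehN.
Qed.

(** Domination by [x ^- n.+1] covers both parities and every real [z], whereas [integral_osc] is
    restricted to one parity and to [z > 0]. *)
Lemma integrable_trig_expV d n rho z : (0 < n)%N -> 0 < rho ->
  mu.-integrable `[rho, +oo[ (EFin \o (fun x => trig d (x * z) / x ^+ n.+1)).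
Proof.
move=> n0 rho0; have pos x : rho <= x -> 0 < x by exact: lt_le_trans.
apply: le_integrable (integrable_expV n0 rho0) => //.
- apply/measurable_EFinP; apply: subspace_continuous_measurable_fun => //.
  by apply: continuous_within_itvcy => x /pos x0; exact: continuous_trig_expV.
- move=> x /=; rewrite in_itv/= andbT => /pos x0.
  by rewrite lee_fin normrM normfV ler_piMl ?trig_le1 ?invr_ge0//.
Qed.

Lemma outer_integral_parity d n rho z : (0 < n)%N -> 0 < rho ->
  mu.-integrable (outer rho) (EFin \o (fun x => trig d (x * z) / x ^+ n.+1)) /\
  \int[mu]_(x in outer rho) (trig d (x * z) / x ^+ n.+1) =
  (odd n != d)%:R * 2 *
    \int[mu]_(x in `[rho, +oo[) (trig d (x * z) / x ^+ n.+1).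
Proof.
move=> n0 rho0.
(* The sign under reflection: [1 + s] is [0] if [odd n = d] and [2] otherwise. *)
pose s : R := (-1) ^+ d * (-1) ^+ n.+1.
have sE x : trig d (- x * z) / (- x) ^+ n.+1 = s * (trig d (x * z) / x ^+ n.+1).
  rewrite mulNr trigN (exprNn x) invfM -exprVn invrN1 /s; ring.
have s01 : 1 + s = (odd n != d)%:R * 2.
  rewrite /s -[(-1) ^+ n.+1]signr_odd -signr_addb /=.
  by case: d {s sE} (odd n) => -[]; rewrite /= ?expr0 ?expr1 ?subrr ?mul0r ?mul1r.
rewrite -s01.
exact: (outer_integral rho0 (fun x _ => sE x) (integrable_trig_expV d z n0 rho0)).
Qed.

(** The parity that survives the symmetry is exactly the one to which [integral_osc] applies. *)
Lemma outer_integral_trig d n rho z : (0 < n)%N -> 0 < rho -> 0 < z ->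
  \int[mu]_(x in outer rho) (trig d (x * z) / x ^+ n.+1) =
  (odd n != d)%:R * 2 *
    (osc_lim R d n * z ^+ n - prim d n (rho * z) / rho ^+ n).
Proof.
move=> n0 rho0 z0; rewrite (outer_integral_parity d z n0 rho0).2.
case: eqVneq => [|odd_n]; rewrite ?mul0r//.
have {}odd_n : odd n = ~~ d by move: odd_n; case: (odd n); case: (d).
by rewrite (integral_osc odd_n n0 rho0 z0).2.
Qed.

End outer_integral.

(** * Termwise integration of the expansion of [p] *)

Section termwise_integration.
Variable R : realType.
Local Notation mu := (@lebesgue_measure R).
Variables (rho : R) (b : nat -> R) (p : R -> R).
Hypothesis rho0 : 0 < rho.
Hypothesis b_cvg : cvgn (series (fun m => `|b m| / rho ^+ m.+2)).
Hypothesis p_sum : forall x, rho <= `|x| ->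
  series (fun m => b m / x ^+ m.+2) @ \oo --> p x.

Let A := limn (series (fun m => `|b m| / rho ^+ m.+2)).

(** For [|x| >= rho], [|x| ^- m.+2] is at most [rho ^- m * |x| ^- 2]. As the expansion starts at
    exponent [2], the bound is integrable and uniform in [N]. *)
Lemma series_outer_bound x N : rho <= `|x| ->
  `|series (fun m => b m / x ^+ m.+2) N| <= A * rho ^+ 2 * x ^- 2.
Proof.
move=> rx; have x0 : 0 < `|x| by exact: lt_le_trans rx.
have -> : A * rho ^+ 2 * x ^- 2 = rho ^+ 2 / `|x| ^+ 2 * A.
  by rewrite real_normK ?num_real//; ring.
apply: (@le_trans _ _ (rho ^+ 2 / `|x| ^+ 2 *
    series (fun m => `|b m| / rho ^+ m.+2) N)); last first.
  rewrite ler_wpM2l ?divr_ge0 ?exprn_ge0 ?(ltW rho0)//.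
  apply: (nondecreasing_cvgn_le _ b_cvg) => i j; apply: nondecreasing_series.
  by move=> n _ _; rewrite divr_ge0// exprn_ge0// ltW.
rewrite (le_trans (ler_norm_sum _ _ _))// mulr_sumr ler_sum// => m _.
rewrite normrM normfV normrX mulrCA ler_wpM2l//.
rewrite [leRHS](_ : _ = rho ^- m * `|x| ^- 2); last first.
  by rewrite !exprS; field; rewrite !expf_neq0 ?gt_eqF.
rewrite [leLHS](_ : _ = `|x| ^- m * `|x| ^- 2); last first.
  by rewrite !exprS; field; rewrite !expf_neq0 ?gt_eqF.
rewrite ler_wpM2r ?invr_ge0 ?exprn_ge0//.
by rewrite lef_pV2 ?posrE ?exprn_gt0// lerXn2r ?nnegrE ?(ltW rho0).
Qed.

(** Dominated convergence with the bound of [series_outer_bound], valid for every real [z]. *)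
Lemma outer_termwise d z :
  mu.-integrable (outer rho) (EFin \o (fun x => trig d (x * z) * p x)) /\
  series (fun m => b m *
    \int[mu]_(x in outer rho) (trig d (x * z) / x ^+ m.+2)) @ \oo -->
  \int[mu]_(x in outer rho) (trig d (x * z) * p x).
Proof.
pose T := measurableTypeR R.
pose t m x : R := trig d (x * z) / x ^+ m.+2.
pose f_ N x := trig d (x * z) * series (fun m => b m / x ^+ m.+2) N.
pose g x := A * rho ^+ 2 * x ^- 2.
have mD := measurable_outer rho.
have it m : mu.-integrable (outer rho) (EFin \o t m) :=
  (outer_integral_parity d z (ltn0Sn m) rho0).1.
have fE N x : f_ N x = \sum_(0 <= m < N) b m * t m x.
  by rewrite /f_ /series/= mulr_sumr; apply: eq_bigr => m _; rewrite /t; ring.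
have ibt m : mu.-integrable (outer rho) (EFin \o (fun x => b m * t m x)%R).
  rewrite (_ : _ \o _ = (fun x => (b m)%:E * (EFin \o (t m)) x)%E).
    exact: integrableZl.
  by apply/funext => x /=; rewrite -EFinM.
have fEE N : EFin \o f_ N =
    (fun x => \sum_(0 <= m < N) (EFin \o (fun x => b m * t m x)%R) x)%E.
  by apply/funext => x /=; rewrite fE sumEFin.
have if_ N : mu.-integrable (outer rho) (EFin \o f_ N).
  by rewrite fEE; apply: integrable_sum.
have If_ N : (\int[mu]_(x in outer rho) (EFin \o f_ N) x)%E =
    (series (fun m => b m * \int[mu]_(x in outer rho) t m x) N)%:E.
  rewrite fEE integral_sum// /series/= -sumEFin; apply: eq_bigr => m _.
  by rewrite -RintegralZl// /Rintegral fineK//;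
    exact: (integrable_fin_num mD (ibt m)).
have ig : mu.-integrable (outer rho) (EFin \o g).
  rewrite (_ : _ \o _ =
      (fun x => (A * rho ^+ 2)%:E * (EFin \o (fun x => x ^- 2)%R) x)%E).
    apply: integrableZl => //.
    (* The ascription sets the reflection sign to [1], because [x ^- 2] is even. *)
    apply: (outer_integral rho0 _ (integrable_expV (ltn0Sn 0) rho0) :
      _ /\ _ = (1 + 1) * _).1.
    by move=> x _; rewrite sqrrN mul1r.
  by apply/funext => x /=; rewrite -EFinM.
have f_cvg x : outer rho x ->
    (EFin \o f_ ^~ x) @ \oo --> (trig d (x * z) * p x)%:E.
  move=> rx; apply: cvg_EFin; first exact: nearW.
  by apply: cvgMl_tmp; exact: p_sum.
have mf : measurable_fun (outer rho : set T)
    (EFin \o (fun x => trig d (x * z) * p x)).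
  apply: (emeasurable_fun_cvg (fun N => EFin \o f_ N)).
    by move=> N; exact: measurable_int (if_ N).
  by move=> x; exact: f_cvg.
have [] := @dominated_convergence _ T R mu (outer rho) mD (fun N => EFin \o f_ N)
  (EFin \o (fun x => trig d (x * z) * p x)) (EFin \o g) _ mf _ ig _.
- by move=> N; exact: measurable_int (if_ N).
- by apply: aeW => x; exact: f_cvg.
- apply: aeW => x N rx /=; rewrite lee_fin normrM.
  rewrite (le_trans (ler_piMl _ (trig_le1 _ _)))//.
  exact: series_outer_bound.
move=> intf _; under [X in X @ _]eq_fun do rewrite If_.
rewrite -(fineK (integrable_fin_num mD intf)) => /fine_cvgP[_ cf].
by split.
Qed.

End termwise_integration.

(** * Interchange of summations in the double series *)

Section double_series.
Variable R : realType.

(** The bound is the tail of the exponential series and does not depend on [f], hence is uniform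
    over a family of such series. *)
Lemma fact_bounded_tail (f : nat -> R) x N : fact_bounded f ->
  `|limn (pseries f x) - pseries f x N| <=
  expR `|x| - series (exp_coeff `|x|) N.
Proof.
move=> fb.
have cl : (fun M => `|pseries f x M - pseries f x N|) @ \oo -->
    `|limn (pseries f x) - pseries f x N|.
  by apply: cvg_norm; apply: cvgB; [exact: fact_bounded_cvg|exact: cvg_cst].
have cr : (fun M => series (exp_coeff `|x|) M - series (exp_coeff `|x|) N) @ \oo
    --> expR `|x| - series (exp_coeff `|x|) N.
  by apply: cvgB; [exact: is_cvg_series_exp_coeff|exact: cvg_cst].
apply: ler_cvg_to cl cr _; near=> M.
have NM : (N <= M)%N by near: M; exact: nbhs_infty_ge.
rewrite /pseries !sub_series_geq// (le_trans (ler_norm_sum _ _ _))//.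
apply: ler_sum => i _.
by rewrite normrM normrX mulrC ler_wpM2l// exprn_ge0.
Unshelve. all: by end_near. Qed.

Lemma series_norm_le_lim (u : nat -> R) N : cvgn (series (fun n => `|u n|)) ->
  series (fun n => `|u n|) N <= limn (series (fun n => `|u n|)).
Proof.
move=> cu; apply: (nondecreasing_cvgn_le _ cu) => i j.
by apply: nondecreasing_series => n _ _; exact: normr_ge0.
Qed.

Variables (al : nat -> R) (q : nat -> nat -> R).
Hypothesis al_cvg : cvgn (series (fun m => `|al m|)).
Hypothesis q_fact : forall m, fact_bounded (q m).

Let A := limn (series (fun m => `|al m|)).

Let A0 : 0 <= A.
Proof.
by apply: le_trans (series_norm_le_lim 0%N al_cvg); rewrite /series/= big_geq.
Qed.

(** Serves with [y m] a coefficient, the value, or a tail of the series of [q m]. *)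
Lemma bounded_combination_cvg (y : nat -> R) (C : R) :
  (forall m, `|y m| <= C) -> cvgn (series (fun m => al m * y m)) /\
  `|limn (series (fun m => al m * y m))| <= A * C.
Proof.
move=> yC; have C0 : 0 <= C by exact: le_trans (yC 0%N).
have cn : cvgn [normed series (fun m => al m * y m)].
  apply: (@series_le_cvg _ _ (C *: (fun m => `|al m|))) => //=.
  - by move=> n; rewrite fctE mulr_ge0.
  - by move=> n; rewrite fctE normrM mulrC ler_wpM2r.
  - exact: is_cvg_seriesZ.
split; first exact: normed_cvg.
have := lim_series_norm cn; move/le_trans; apply.
apply: limr_le => //; apply: nearW => N; rewrite /series/=.
apply: (@le_trans _ _ (\sum_(0 <= m < N) `|al m| * C)).
  by apply: ler_sum => m _; rewrite normrM ler_wpM2l.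
by rewrite -mulr_suml ler_wpM2r//; exact: series_norm_le_lim.
Qed.

Definition mixed_coef j := limn (series (fun m => al m * q m j)).

Lemma mixed_coef_le j : `|mixed_coef j| <= A / j`!%:R.
Proof. exact: (bounded_combination_cvg (fun m => q_fact m j)).2. Qed.

(** Truncated at [N] powers of [s], the interchange is a finite sum of limits. The error is at most
    [A] times the tail of the exponential series, by [fact_bounded_tail] uniformly in [m], and tends
    to [0]. *)
Lemma series_mixed_coef s :
  series (fun j => mixed_coef j * s ^+ j) @ \oo -->
  limn (series (fun m => al m * limn (pseries (q m) s))).
Proof.
have cQ : cvgn (series (fun m => al m * limn (pseries (q m) s))).
  exact: (bounded_combination_cvg (fun m => fact_bounded_le s (q_fact m))).1.
have cN N : series (fun m => al m * pseries (q m) s N) @ \oo -->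
    series (fun j => mixed_coef j * s ^+ j) N.
  rewrite (_ : series _ =
      fun M => \sum_(0 <= j < N) series (fun m => al m * q m j) M * s ^+ j).
    apply: (cvg_big (op := +%R)) => [|j _]; first exact: add_continuous.
    apply: cvgMr_tmp.
    exact: (bounded_combination_cvg (fun m => q_fact m j)).1.
  apply/funext => M; rewrite /pseries /series/=.
  under eq_bigr do rewrite mulr_sumr.
  rewrite exchange_big/=; apply: eq_bigr => j _.
  by rewrite mulr_suml; apply: eq_bigr => m _; rewrite mulrA.
have diff N : `|limn (series (fun m => al m * limn (pseries (q m) s))) -
    series (fun j => mixed_coef j * s ^+ j) N| <=
    A * (expR `|s| - series (exp_coeff `|s|) N).
  have [_] := @bounded_combination_cvg
    (fun m => limn (pseries (q m) s) - pseries (q m) s N)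
    _ (fun m => fact_bounded_tail s N (q_fact m)).
  rewrite (_ : limn _ = limn (series (fun m => al m * limn (pseries (q m) s))) -
    series (fun j => mixed_coef j * s ^+ j) N)//.
  apply/cvg_lim => //.
  rewrite (_ : series _ = series (fun m => al m * limn (pseries (q m) s)) -
      series (fun m => al m * pseries (q m) s N)); first exact: cvgB.
  apply/funext => M; rewrite !fctE /series/= -sumrB.
  by apply: eq_bigr => m _; rewrite mulrBr.
apply/cvgrPdist_le => e e0.
have : (fun N => A * (expR `|s| - series (exp_coeff `|s|) N)) @ \oo -->
    A * (expR `|s| - expR `|s|).
  apply: cvgMl_tmp; apply: cvgB; first exact: cvg_cst.
  exact: is_cvg_series_exp_coeff.
rewrite subrr mulr0.
move/cvgrPdist_le => /(_ e e0); apply: filterS => N.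
rewrite sub0r normrN; apply: le_trans; apply: (le_trans (diff N)).
exact: ler_norm.
Qed.

Lemma mixed_coef_norm_cvg s : 0 <= s ->
  cvgn (series (fun j => `|mixed_coef j| * s ^+ j)).
Proof.
move=> s0.
apply: (@series_le_cvg _ _ (A *: exp_coeff s)).
- by move=> j; rewrite mulr_ge0// exprn_ge0.
- by move=> j; rewrite mulr_ge0// exp_coeff_ge0.
- move=> j; apply: (@le_trans _ _ (A / j`!%:R * s ^+ j)).
    by rewrite ler_wpM2r ?exprn_ge0// mixed_coef_le.
  by rewrite -mulrA [_^-1 * _]mulrC.
- exact/is_cvg_seriesZ/is_cvg_series_exp_coeff.
Qed.

End double_series.

(** * Power series of the cosine and sine integrals of [p] *)

Section power_series_of_integral.
Variable R : realType.
Local Notation mu := (@lebesgue_measure R).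
Variables (rho : R) (b : nat -> R) (p : R -> R) (d : bool).
Hypothesis rho0 : 0 < rho.
Hypothesis b_cvg : cvgn (series (fun m => `|b m| / rho ^+ m.+2)).
Hypothesis p_sum : forall x, rho <= `|x| ->
  series (fun m => b m / x ^+ m.+2) @ \oo --> p x.

(** For [z > 0] the [m]-th term of [p] contributes [e m * osc_lim R d m.+1 * z ^ m.+1 - al m * prim
    d m.+1 (rho * z)]. The first summands are already monomials, collected in [lim_part]; the second
    ones form the double series with rows [q m]. *)
Let e m := b m * ((odd m.+1 != d)%:R * 2).
Let al m := e m / rho ^+ m.+1.
Let q m := @prim_coef R d m.+1.
Let lim_part j := if j is m.+1 then e m * osc_lim R d m.+1 else 0.

Let al_cvg : cvgn (series (fun m => `|al m|)).
Proof.
(* The factor [2] bounds the parity weight, and [rho] accounts for the exponent [m.+1] instead of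
   [m.+2]. *)
apply: (@series_le_cvg _ _ ((2 * rho) *: (fun m => `|b m| / rho ^+ m.+2))) => //.
- by move=> m; rewrite mulr_ge0 ?mulr_ge0 ?invr_ge0 ?exprn_ge0 ?(ltW rho0).
- move=> m; rewrite /al /e normrM normfV normrM [`|rho ^+ _|]gtr0_norm ?exprn_gt0//.
  rewrite fctE (_ : _ *: _ = `|b m| * 2 / rho ^+ m.+1); last first.
    by rewrite /GRing.scale/= !exprS; field; rewrite expf_neq0 ?gt_eqF.
  rewrite ler_wpM2r ?invr_ge0 ?exprn_ge0 ?(ltW rho0)// ler_wpM2l//.
  by case: (_ != _); rewrite ger0_norm ?mul1r ?mul0r.
- exact: is_cvg_seriesZ.
Qed.

(* Both terms in [osc_lim = osc (rho * z) - (osc (rho * z) - osc_lim)] are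
   bounded by a multiple, independent of [m], of [(rho * z) ^- m.+1]. *)
Let lim_part_le z m : 0 < z ->
  `|lim_part m.+1| * z ^+ m.+1 <= (expR (rho * z) + 1) * `|al m|.
Proof.
move=> z0; rewrite /lim_part /al /e.
have [_|odd_m] := eqVneq (odd m.+1) d; first by rewrite !(mul0r, mulr0, normr0).
have {}odd_m : odd m.+1 = ~~ d by move: odd_m; case: (odd m.+1); case: (d).
rewrite mul1r !normrM normfV.
have s0 : 0 < rho * z by exact: mulr_gt0.
rewrite [`|rho ^+ _|]gtr0_norm ?exprn_gt0//.
set K := `|osc_lim R d m.+1|; set E := expR _ + 1.
rewrite [leLHS](_ : _ = `|b m| * `|2| * (z ^+ m.+1 * K)); last by ring.
rewrite [leRHS](_ : _ = `|b m| * `|2| * ((rho ^+ m.+1)^-1 * E)); last by ring.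
rewrite ler_wpM2l ?mulr_ge0// {}/K {}/E.
rewrite ler_pdivlMl ?exprn_gt0// mulrA -exprMn.
have -> : (rho * z) ^+ m.+1 * `|osc_lim R d m.+1| =
    `|(rho * z) ^+ m.+1 * osc_lim R d m.+1|.
  by rewrite normrM [`|_ ^+ _|]gtr0_norm ?exprn_gt0.
have -> : (rho * z) ^+ m.+1 * osc_lim R d m.+1 =
  prim d m.+1 (rho * z) -
    (rho * z) ^+ m.+1 * (osc d m.+1 (rho * z) - osc_lim R d m.+1).
  by rewrite /osc; field; rewrite ?expf_neq0 ?gt_eqF.
apply: le_trans (ler_normB _ _) _; apply: lerD.
  by have := prim_le d m.+1 (rho * z); rewrite [`|rho * z|]gtr0_norm.
rewrite normrM [`|_ ^+ _|]gtr0_norm ?exprn_gt0//.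
by rewrite -ler_pdivlMl ?exprn_gt0// mulr1 osc_limP.
Qed.

Let lim_part_cvg t : 0 <= t -> cvgn (series (fun j => `|lim_part j| * t ^+ j)).
Proof.
(* [lim_part_le] asks for a positive argument; comparison at [t + 1] includes [t = 0]. *)
move=> t0; have lt0 : 0 < t + 1 by rewrite ltr_wpDl.
have cS : cvgn (series (fun m => `|lim_part m.+1| * t ^+ m.+1)).
  apply: (@series_le_cvg _ _ ((expR (rho * (t + 1)) + 1) *: (fun m => `|al m|))).
  - by move=> m; rewrite mulr_ge0 ?exprn_ge0.
  - by move=> m; rewrite mulr_ge0 ?addr_ge0 ?expR_ge0.
  - move=> m; apply: le_trans (lim_part_le m lt0).
    by rewrite ler_wpM2l// lerXn2r ?nnegrE ?(ltW lt0)// lerDl.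
  - exact: is_cvg_seriesZ.
apply/cvg_ex; eexists; rewrite -cvg_shiftS.
rewrite (_ : [sequence _]_n = series (fun m => `|lim_part m.+1| * t ^+ m.+1)).
  exact: cS.
by apply/funext => N; rewrite /series/= big_nat_recl// normr0 mul0r add0r.
Qed.

(** Absolute convergence is recorded for all [t >= 0], although the sum is identified only for
    [z > 0], because the same coefficients are later evaluated at complex arguments. *)
Lemma trig_integral_power_series : exists u : nat -> R,
  (forall t, 0 <= t -> cvgn (series (fun j => `|u j| * t ^+ j))) /\
  forall z, 0 < z -> series (fun j => u j * z ^+ j) @ \oo -->
    \int[mu]_(x in outer rho) (trig d (x * z) * p x).
Proof.
pose v j := mixed_coef al q j * rho ^+ j.
have q_fact m : fact_bounded (q m) by exact: prim_coef_fact.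
exists (fun j => lim_part j - v j); split=> [t t0|z z0].
  apply: (@series_le_cvg _ _ ((fun j => `|lim_part j| * t ^+ j) +
      (fun j => `|mixed_coef al q j| * (rho * t) ^+ j))).
  - by move=> j; rewrite mulr_ge0 ?exprn_ge0.
  - by move=> j; rewrite fctE addr_ge0 ?mulr_ge0 ?exprn_ge0 ?mulr_ge0 ?(ltW rho0).
  - move=> j; rewrite fctE exprMn mulrA -mulrDl ler_wpM2r ?exprn_ge0//.
    apply: le_trans (ler_normB _ _) _; rewrite lerD2l /v normrM.
    by rewrite [`|rho ^+ _|]gtr0_norm ?exprn_gt0.
  - apply: is_cvg_seriesD; first exact: lim_part_cvg.
    by apply: mixed_coef_norm_cvg => //; rewrite mulr_ge0// ltW.
have c1 : cvgn (series (fun j => lim_part j * z ^+ j)).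
  apply: normed_cvg.
  rewrite (_ : [normed series _] = series (fun j => `|lim_part j| * z ^+ j)).
    exact/lim_part_cvg/ltW.
  apply/funext => N; apply: eq_bigr => j _.
  by rewrite /= normrM [`|z ^+ _|]gtr0_norm ?exprn_gt0.
have c2 : cvgn (series (fun m => al m * prim d m.+1 (rho * z))).
  exact: (bounded_combination_cvg al_cvg (fun m => prim_le d m.+1 (rho * z))).1.
have c3 := series_mixed_coef (s := rho * z) al_cvg q_fact.
have [_] := outer_termwise rho0 b_cvg p_sum d z.
(* As [lim_part 0 = 0], the first [N] integrals use the powers of [z] up to [N], that is [N.+1]
   terms. *)
rewrite (_ : series _ = (fun N => series (fun j => lim_part j * z ^+ j) N.+1 -
     series (fun m => al m * prim d m.+1 (rho * z)) N)); last first.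
  apply/funext => N; rewrite /series/= big_nat_recl// mul0r add0r -sumrB.
  apply: eq_bigr => m _; rewrite outer_integral_trig// /lim_part /al /e.
  by field; rewrite expf_neq0 ?gt_eqF.
move/cvg_lim => <- //.
rewrite (_ : lim _ = limn (series (fun j => lim_part j * z ^+ j)) -
    limn (series (fun m => al m * prim d m.+1 (rho * z)))); last first.
  apply/cvg_lim => //; apply: cvgB => //.
  by rewrite (cvg_shiftS (series _)).
rewrite (_ : series _ = series (fun j => lim_part j * z ^+ j) -
    series (fun j => mixed_coef al q j * (rho * z) ^+ j)); first exact: cvgB.
apply/funext => N; rewrite !fctE /series/= -sumrB.
by apply: eq_bigr => j _; rewrite /v exprMn; ring.
Qed.

End power_series_of_integral.

(** * Second-order remainder of a power *)

Local Open Scope complex_scope.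

Lemma le_expD_sub_linear (K : numDomainType) (w h : K) n : `|h| <= 1 ->
  `|(w + h) ^+ n.+1 - w ^+ n.+1 - h * (n.+1%:R * w ^+ n)| <=
  `|h| ^+ 2 * (1 + `|w|) ^+ n.+1.
Proof.
move=> h1; set t := `|w|.
have t0 : 0 <= t by exact: normr_ge0.
(* The sharper bound is the same remainder taken at [w = t] and [h = 1]; both sides obey the same
   recurrence in [n], which drives the induction. *)
suff : `|(w + h) ^+ n.+1 - w ^+ n.+1 - h * (n.+1%:R * w ^+ n)| <=
    `|h| ^+ 2 * ((1 + t) ^+ n.+1 - t ^+ n.+1 - n.+1%:R * t ^+ n).
  move=> /le_trans; apply; rewrite ler_wpM2l ?exprn_ge0//.
  by rewrite -addrA gerDl -opprD oppr_le0 addr_ge0 ?mulr_ge0 ?exprn_ge0.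
elim: n => [|n IH].
  rewrite (_ : _ - _ = 0); last by ring.
  by rewrite normr0 mulr_ge0 ?exprn_ge0// (_ : _ - _ = 0)//; ring.
rewrite (_ : _ - _ =
    (w + h) * ((w + h) ^+ n.+1 - w ^+ n.+1 - h * (n.+1%:R * w ^+ n))
   + h ^+ 2 * (n.+1%:R * w ^+ n)); last by rewrite !exprS; ring.
rewrite [leRHS](_ : _ =
    (1 + t) * (`|h| ^+ 2 * ((1 + t) ^+ n.+1 - t ^+ n.+1 - n.+1%:R * t ^+ n))
   + `|h| ^+ 2 * (n.+1%:R * t ^+ n)); last by rewrite !exprS; ring.
apply: le_trans (ler_normD _ _) _; apply: lerD.
  by rewrite normrM ler_pM// addrC (le_trans (ler_normD _ _))// lerD2r.
by rewrite !normrM !normrX normr_nat.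
Qed.

(** * Convergence of complex sequences and power series *)

Section complex_convergence.
Variable R : realType.
Local Notation normc := ComplexField.Normc.normc.
Implicit Types z : R[i].

Lemma normrE z : `|z| = (normc z)%:C.
Proof. by []. Qed.

Lemma normc_ge0 z : 0 <= normc z.
Proof. by case: z => a b; exact: sqrtr_ge0. Qed.

Lemma abs_Re_le z : `|complex.Re z| <= normc z.
Proof. by case: z => a b /=; rewrite -sqrtr_sqr ler_wsqrtr// lerDl sqr_ge0. Qed.

Lemma abs_Im_le z : `|complex.Im z| <= normc z.
Proof. by case: z => a b /=; rewrite -sqrtr_sqr ler_wsqrtr// lerDr sqr_ge0. Qed.

Lemma normc_le z : normc z <= `|complex.Re z| + `|complex.Im z|.
Proof.
case: z => a b /=; rewrite -[leRHS]ger0_norm ?addr_ge0// -sqrtr_sqr ler_wsqrtr//.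
by rewrite sqrrD !real_normK ?num_real// -addrA lerD2l lerDr mulrn_wge0 ?mulr_ge0.
Qed.

Lemma cvg_complex (T : Type) (F : set_system T) (FF : Filter F)
    (f : T -> R[i]^o) (x y : R) :
  (fun t => complex.Re (f t)) @ F --> x ->
  (fun t => complex.Im (f t)) @ F --> y ->
  f @ F --> (x +i* y : R[i]^o).
Proof.
(* A positive element of [R[i]] is real, so [e'] is [0] and [e] is a positive real. *)
move=> fx fy; apply/cvgrPdist_le => -[e e'] /=; rewrite ltcE/= => /andP[/eqP-> e0].
have e20 : 0 < e / 2 by rewrite divr_gt0.
move/cvgrPdist_le : fx => /(_ _ e20) fx; move/cvgrPdist_le : fy => /(_ _ e20) fy.
have ReB s : complex.Re (x +i* y - s) = x - complex.Re s by case: s.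
have ImB s : complex.Im (x +i* y - s) = y - complex.Im s by case: s.
near=> t; rewrite normrE lecR (le_trans (normc_le _))//.
rewrite [leRHS]splitr lerD//.
  by rewrite ReB; near: t.
by rewrite ImB; near: t.
Unshelve. all: by end_near. Qed.

Lemma cvg_norm_le (u : nat -> R[i]^o) (l : R[i]^o) (M : R) :
  u @ \oo --> l -> (forall n, `|u n| <= M%:C) -> `|l| <= M%:C.
Proof.
move=> ul uM; rewrite normrE lecR; apply/ler_addgt0Pr => e e0.
have e0' : 0 < e%:C by rewrite ltcR.
have /cvgrPdist_le /(_ _ e0') [N _ /(_ N (leqnn N))] := ul.
rewrite normrE lecR => dN; rewrite -[l](subrK (u N)) addrC.
by apply: le_trans (le_normcD _ _) _; rewrite lerD// -lecR; exact: uM.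
Qed.

Variable b : nat -> R[i].
Hypothesis b_cvg : forall t : R, 0 <= t ->
  cvgn (series (fun n => normc (b n) * t ^+ n)).

Definition cpartial (z : R[i]) (N : nat) : R[i]^o :=
  \sum_(0 <= n < N) b n * z ^+ n.

(** The limit is taken componentwise, as in [Cintegral], which reduces convergence to real
    series. *)
Definition cpower z : R[i]^o :=
  limn (fun N => complex.Re (cpartial z N)) +i*
  limn (fun N => complex.Im (cpartial z N)).

Lemma normcX z n : normc (z ^+ n) = normc z ^+ n.
Proof.
elim: n => [|n IH]; first by rewrite !expr0 ComplexField.Normc.normc1.
by rewrite !exprS ComplexField.Normc.normcM IH.
Qed.

Lemma cpartial_cvg z : cpartial z @ \oo --> cpower z.
Proof.
(* [g] is the real or the imaginary part: additive and dominated by [normc]. *)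
have cvg_part (g : R[i] -> R) : {morph g : x y / x + y} -> g 0 = 0 ->
    (forall x, `|g x| <= normc x) -> cvgn (fun N => g (cpartial z N)).
  move=> gD g0 gle.
  rewrite (_ : (fun N => _) = series (fun n => g (b n * z ^+ n))); last first.
    by apply/funext => N; rewrite /cpartial /series/= (big_morph g gD g0).
  apply: normed_cvg.
  apply: (@series_le_cvg _ _ (fun n => normc (b n) * normc z ^+ n)) => //=.
  - by move=> n; rewrite mulr_ge0 ?exprn_ge0 ?normc_ge0.
  - by move=> n; rewrite (le_trans (gle _))// ComplexField.Normc.normcM normcX.
  - exact/b_cvg/normc_ge0.
apply: cvg_complex; apply: cvg_part => //.
- by case=> ? ? [].
- exact: abs_Re_le.
- by case=> ? ? [].
- exact: abs_Im_le.
Qed.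

End complex_convergence.

(** * Complex differentiability of an everywhere convergent power series *)

Section entire_power_series.
Variable R : realType.
Local Notation normc := ComplexField.Normc.normc.
Variable b : nat -> R[i].
Hypothesis b_cvg : forall t : R, 0 <= t ->
  cvgn (series (fun n => normc (b n) * t ^+ n)).

Let b' n := n.+1%:R * b n.+1.

Let shift_cvg t : 0 <= t -> cvgn (series (fun n => normc (b n.+1) * t ^+ n.+1)).
Proof.
move=> t0; apply/cvg_ex.
exists (limn (series (fun n => normc (b n) * t ^+ n)) - normc (b 0%N)).
rewrite (_ : series _ =
    (fun N => series (fun n => normc (b n) * t ^+ n) N.+1 - normc (b 0%N))).
  apply: cvgB; last exact: cvg_cst.
  by rewrite (cvg_shiftS (series _)); exact: b_cvg.
by apply/funext => N; rewrite /series/= big_nat_recl// expr0 mulr1 addrC addKr.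
Qed.

(** Comparison at the larger radius [1 + t], since [n.+1 * t ^ n <= (1 + t) ^ n.+1]. *)
Let b'_cvg t : 0 <= t -> cvgn (series (fun n => normc (b' n) * t ^+ n)).
Proof.
move=> t0; have t10 : 0 <= 1 + t by rewrite addr_ge0.
apply: series_le_cvg (shift_cvg t10).
- by move=> n; rewrite mulr_ge0 ?exprn_ge0 ?normc_ge0.
- by move=> n; rewrite mulr_ge0 ?exprn_ge0 ?normc_ge0.
move=> n; rewrite /b' ComplexField.Normc.normcM mulrAC mulrC ler_wpM2l ?normc_ge0//.
rewrite (_ : normc n.+1%:R = n.+1%:R); last first.
  by rewrite -(rmorph_nat (real_complex R)) /= expr0n addr0 sqrtr_sqr normr_nat.
elim: n => [|n IH]; first by rewrite expr0 expr1 mul1r lerDl.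
rewrite -natr1 mulrDl mul1r exprS [leRHS]exprS mulrDl mul1r addrC lerD//.
  by rewrite -exprS lerXn2r ?nnegrE// lerDr.
by rewrite mulrCA ler_wpM2l.
Qed.

(** [le_expD_sub_linear] bounds each term by [|h| ^ 2] times a summable quantity independent of [h];
    the bound on partial sums passes to the limit. *)
Lemma cpower_expansion z h : `|h| <= 1 ->
  `|cpower b (z + h) - cpower b z - h * cpower b' z| <=
  `|h| ^+ 2 * (limn (series (fun n => normc (b n.+1) * (1 + normc z) ^+ n.+1)))%:C.
Proof.
move=> h1; have t10 : 0 <= 1 + normc z by rewrite addr_ge0 ?normc_ge0.
(* The constant terms cancel, so [N.+1] terms of the series match [N] terms of the derived one. *)
pose u N := cpartial b (z + h) N.+1 - cpartial b z N.+1 - h * cpartial b' z N.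
have ul : u @ \oo --> (cpower b (z + h) - cpower b z - h * cpower b' z : R[i]^o).
  apply: cvgB; first apply: cvgB.
  - by rewrite (cvg_shiftS (cpartial b (z + h))); exact: cpartial_cvg.
  - by rewrite (cvg_shiftS (cpartial b z)); exact: cpartial_cvg.
  - by apply: cvgMl_tmp; exact: cpartial_cvg.
set L := limn _.
have hL : `|h| ^+ 2 * L%:C = (normc h ^+ 2 * L)%:C.
  by rewrite normrE -rmorphXn -rmorphM.
rewrite hL; apply: (cvg_norm_le ul) => N; rewrite -hL.
rewrite (_ : u N = \sum_(0 <= n < N) b n.+1 *
    ((z + h) ^+ n.+1 - z ^+ n.+1 - h * (n.+1%:R * z ^+ n))); last first.
  rewrite /u /cpartial !big_nat_recl// !expr0 mulr_sumr opprD addrACA subrr add0r.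
  by rewrite -!sumrB; apply: eq_bigr => n _; rewrite /b'; ring.
apply: le_trans (ler_norm_sum _ _ _) _.
apply: (@le_trans _ _ (\sum_(0 <= n < N)
    `|h| ^+ 2 * (normc (b n.+1) * (1 + normc z) ^+ n.+1)%:C)).
  apply: ler_sum => n _.
  have -> : (normc (b n.+1) * (1 + normc z) ^+ n.+1)%:C =
      `|b n.+1| * (1 + `|z|) ^+ n.+1.
    by rewrite !normrE rmorphM rmorphXn rmorphD rmorph1.
  rewrite normrM [leRHS]mulrCA.
  by rewrite ler_wpM2l// le_expD_sub_linear.
rewrite -mulr_sumr ler_wpM2l ?exprn_ge0// -rmorph_sum lecR.
apply: (nondecreasing_cvgn_le _ (shift_cvg t10)) => i j.
by apply: nondecreasing_series => n _ _; rewrite mulr_ge0 ?exprn_ge0 ?normc_ge0.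
Qed.

(** By [cpower_expansion], the difference quotient is within [|h| * M] of the derived series. *)
Lemma entire_cpower : entire (cpower b).
Proof.
move=> z; pose y n := normc (b n.+1) * (1 + normc z) ^+ n.+1.
set M := limn (series y).
have M0 : 0 <= M.
  apply: (@le_trans _ _ (series y 0%N)); first by rewrite /series/= big_geq.
  apply: nondecreasing_cvgn_le.
    move=> i j; apply: nondecreasing_series => n _ _.
    by rewrite mulr_ge0 ?exprn_ge0 ?addr_ge0 ?normc_ge0.
  by apply: shift_cvg; rewrite addr_ge0 ?normc_ge0.
apply/cvg_ex; exists (cpower b' z); apply/cvgrPdist_le => e e0.
(* Adding [1] keeps the divisor positive when [M = 0]. *)
have M1 : 0 < M%:C + 1 :> R[i] by rewrite ltr_wpDl// ler0c.
near=> h.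
have h0 : h != 0 by near: h; exact: nbhs_dnbhs_neq.
have h1 : `|h| <= 1 by near: h; exact: dnbhs0_le.
have he : `|h| <= e / (M%:C + 1).
  by near: h; apply: dnbhs0_le; rewrite divr_gt0.
have := cpower_expansion z h1; rewrite -/y -/M.
rewrite (_ : cpower b' z - _ =
    - (h^-1 * (cpower b (z + h) - cpower b z - h * cpower b' z))); last first.
  by rewrite /= /GRing.scale/= mulr1 [h + z]addrC; field; exact: h0.
move=> H; rewrite normrN normrM normfV ler_pdivrMl ?normr_gt0//.
apply: le_trans H _; rewrite expr2 -mulrA ler_wpM2l//.
apply: (@le_trans _ _ (`|h| * (M%:C + 1))); first by rewrite ler_wpM2l// lerDl.
by rewrite -ler_pdivlMr.
Unshelve. all: by end_near. Qed.

End entire_power_series.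

(** * Passage from [lam] to Lebesgue measure *)

Section density.
Variable R : realType.
Local Notation mu := (@lebesgue_measure R).
Local Notation T := (measurableTypeR R).

(** The density [f] has the same integral as the Radon-Nikodym derivative over every measurable set,
    hence equals it almost everywhere. *)
Lemma finite_integral_density (nu : {finite_measure set T -> \bar R})
    (f : R -> R) (g : R -> R) :
  mu.-integrable setT (EFin \o f) -> has_density nu f ->
  nu.-integrable setT (EFin \o g) ->
  \int[nu]_x g x = \int[mu]_x (g x * f x).
Proof.
move=> intf nuf intg.
have numu : nu `<< mu.
  apply/null_content_dominatesP => A mA muA0; rewrite nuf//.
  apply: null_set_integral => //.
  exact: measurable_funTS (measurable_int _ intf).
have mg : measurable_fun [set: T] (EFin \o g) := measurable_int _ intg.
rewrite /Rintegral; congr fine.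
rewrite -(Radon_Nikodym_change_of_variables numu measurableT intg).
apply: ae_eq_integral => //.
- exact: emeasurable_funM.
- have mf : measurable_fun [set: T] (EFin \o f) := measurable_int _ intf.
  exact: (emeasurable_funM mg mf).
- have H : ae_eq mu setT (Radon_Nikodym (charge_of_finite_measure nu) mu)
      (EFin \o f).
    apply: integral_ae_eq => //.
    + exact: Radon_Nikodym_integrable.
    + exact: measurable_int intf.
    + by move=> E _ mE; rewrite -Radon_Nikodym_integral//=; exact: nuf.
  exact: (@ae_eqe_mul2l _ _ _ mu _ _ _ (EFin \o g) H).
Qed.

Lemma integral_density_trig (lam : {measure set T -> \bar R}) (f : R -> R) d z :
  mu.-integrable setT (EFin \o f) -> has_density lam f ->
  \int[lam]_x trig d (x * z) = \int[mu]_x (trig d (x * z) * f x).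
Proof.
move=> intf lamf.
have lam_fin : fin_num_fun lam.
  move=> A mA; rewrite lamf//; apply: integrable_fin_num => //.
  exact: integrableS intf.
have lam_sigma : sigma_finite setT lam.
  by apply: fin_num_fun_sigma_finite; rewrite ?measure0.
pose H1 := isFinite.Build _ _ _ _ lam_fin.
pose H2 := isSFinite.Build _ _ _ _ (sfinite_measure_sigma_finite lam_sigma).
pose H3 := isSigmaFinite.Build _ _ _ _ lam_sigma.
(* [nu] is [lam] itself, equipped with the finiteness that integrability of [f] provides. *)
pose nu := HB.pack_for (FiniteMeasure.type T R) (Measure.sort lam) H1 H2 H3.
have tz_cont : continuous (fun x : R => trig d (x * z)).
  move=> x; apply: (@cvg_comp _ _ _ (fun x => x * z) (trig d)).
    exact: mulrr_continuous.
  exact: continuous_trig.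
apply: (@finite_integral_density nu f (fun x => trig d (x * z))) => //.
apply: measurable_bounded_integrable => //.
- exact: fin_num_fun_lty lam_fin.
- exact: continuous_measurable_fun.
- by exists 1; split=> // M M1 x _; exact: le_trans (trig_le1 _ _) (ltW M1).
Qed.

End density.

(** * The entire extension of the Fourier transform *)

Lemma outer_restrict (R : realType) (rho : R) (f : R -> R) :
  f \_ (outer rho) = (fun x => f x * \1_[set y : R | rho <= `|y|] x).
Proof.
apply/funext => x; rewrite patchE indicE.
by case: (x \in _); rewrite ?mulr1 ?mulr0.
Qed.

Theorem proposition2p3 (R : realType) (r rho : R) (a : nat -> R) (p : R -> R)
    (lam : {measure set (measurableTypeR R) -> \bar R})
    (r_gt0 : 0 < r) (r_lt_rho : r < rho)
    (a_abs_cvg : forall x : R, r < `|x| ->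
       cvgn (fun N : nat => \sum_(2 <= n < N) `|a n / x ^+ n| : R))
    (p_sum : forall x : R, r < `|x| ->
       (fun N : nat => \sum_(2 <= n < N) a n / x ^+ n : R) @ \oo --> p x)
    (p_ge0 : forall x : R, rho <= `|x| -> 0 <= p x)
    (lam_density :
       has_density lam (fun x : R => p x * \1_[set y : R | rho <= `|y|] x)) :
  exists F : R[i]^o -> R[i]^o,
    [/\ entire F,
        (forall z : R, 0 < z -> F z%:C = fourier lam z) &
        exists c : nat -> R[i], forall z : R[i]^o,
          (fun N : nat =>
             \sum_(0 <= n < N) (c n / n`!%:R * ('i%C * z) ^+ n) : R[i]^o)
            @ \oo --> F z].
Proof.
have rho0 : 0 < rho by exact: lt_trans r_lt_rho.
pose b m := a m.+2.
(* Sums starting at index [2] become ordinary series after a shift by two, undone below by two uses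
   of [cvg_shiftS]. *)
have shift2 (u : nat -> R) :
    (fun N : nat => \sum_(2 <= n < N.+2) u n) = series (fun m => u m.+2).
  by apply/funext => N; rewrite !big_add1.
have b_cvg : cvgn (series (fun m => `|b m| / rho ^+ m.+2)).
  have := a_abs_cvg rho; rewrite gtr0_norm// => /(_ r_lt_rho) ca.
  apply/cvg_ex; eexists.
  rewrite (_ : series _ = series (fun m => `|a m.+2 / rho ^+ m.+2|)).
    rewrite -(shift2 (fun n => `|a n / rho ^+ n|)).
    rewrite (cvg_shiftS (fun N => \sum_(2 <= n < N.+1) `|a n / rho ^+ n|)).
    rewrite (cvg_shiftS (fun N => \sum_(2 <= n < N) `|a n / rho ^+ n|)).
    exact: ca.
  congr series; apply/funext => m.
  by rewrite normrM normfV [`|_ ^+ _|]gtr0_norm ?exprn_gt0.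
have pb_sum x : rho <= `|x| -> series (fun m => b m / x ^+ m.+2) @ \oo --> p x.
  move=> rx; rewrite -(shift2 (fun n => a n / x ^+ n)).
  rewrite (cvg_shiftS (fun N => \sum_(2 <= n < N.+1) a n / x ^+ n)).
  rewrite (cvg_shiftS (fun N => \sum_(2 <= n < N) a n / x ^+ n)).
  by apply: p_sum; exact: lt_le_trans rx.
pose f x := p x * \1_[set y : R | rho <= `|y|] x.
have intf : (@lebesgue_measure R).-integrable setT (EFin \o f).
  (* At [z = 0] the cosine is [1], which gives the integrability of [p] on [outer rho]. *)
  have [ip _] := outer_termwise rho0 b_cvg pb_sum false 0.
  have := (integrable_mkcond _ (measurable_outer rho)).1 ip.
  rewrite restrict_EFin outer_restrict; congr (is_true (integrable _ _ _)).
  by apply/funext => x; rewrite /= mulr0 cos0 mul1r.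
have lam_trig d z : \int[lam]_x trig d (x * z) =
    \int[@lebesgue_measure R]_(x in outer rho) (trig d (x * z) * p x).
  rewrite (integral_density_trig d z intf lam_density).
  rewrite [RHS]Rintegral_mkcond outer_restrict.
  by apply: eq_Rintegral => x _; rewrite mulrA.
have [u [u_cvg u_sum]] := trig_integral_power_series false rho0 b_cvg pb_sum.
have [v [v_cvg v_sum]] := trig_integral_power_series true rho0 b_cvg pb_sum.
(* At real [z] the series in [w] splits into the cosine integral as real part and the sine integral
   as imaginary part. *)
pose w n := u n +i* v n.
have w_cvg t : 0 <= t ->
    cvgn (series (fun n => ComplexField.Normc.normc (w n) * t ^+ n)).
  move=> t0.
  apply: (@series_le_cvg _ _ ((fun n => `|u n| * t ^+ n) +
    (fun n => `|v n| * t ^+ n))).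
  - by move=> n; rewrite mulr_ge0 ?normc_ge0 ?exprn_ge0.
  - by move=> n; rewrite fctE addr_ge0 ?mulr_ge0 ?exprn_ge0.
  - by move=> n; rewrite fctE -mulrDl ler_wpM2r ?exprn_ge0// normc_le.
  - by apply: is_cvg_seriesD; [exact: u_cvg|exact: v_cvg].
exists (cpower w); split.
- exact: entire_cpower.
- move=> z z0.
  have zE N : cpartial w z%:C N =
      series (fun n => u n * z ^+ n) N +i* series (fun n => v n * z ^+ n) N.
    elim: N => [|N IH]; first by rewrite /cpartial /series/= !big_geq.
    rewrite /cpartial /series/= !big_nat_recr//= -/(cpartial w z%:C N) IH.
    by rewrite -rmorphXn /w; simpc.
  rewrite /cpower /fourier /Cintegral /expi/=; congr (_ +i* _).
  + rewrite (_ : (fun N => _) = series (fun n => u n * z ^+ n)); last first.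
      by apply/funext => N; rewrite zE.
    by rewrite (cvg_lim _ (u_sum z z0))// -lam_trig.
  + rewrite (_ : (fun N => _) = series (fun n => v n * z ^+ n)); last first.
      by apply/funext => N; rewrite zE.
    by rewrite (cvg_lim _ (v_sum z z0))// -lam_trig.
(* The witness undoes the normalisation [(i z) ^ n / n!], so the partial sums are those of
   [cpower w]. *)
- exists (fun n => w n * n`!%:R / 'i%C ^+ n) => z.
  rewrite (_ : (fun N => _) = cpartial w z); first exact: cpartial_cvg.
  apply/funext => N; apply: eq_bigr => n _.
  have i0 : 'i%C != 0 :> R[i] by rewrite eq_complex /= oner_eq0 andbF.
  by rewrite exprMn; field; rewrite expf_neq0//= pnatr_eq0 -lt0n fact_gt0.
Qed.
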